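(* Let $p$ be a prime, and let $K=\{k_1,k_2,\ldots,k_r\}$ and $L=\{l_1,l_2,\ldots,l_s\}$ be two disjoint subsets of $\{0,1,\ldots,p-1\}$ (with $r=|K|\ge 1$, $s=|L|$). Let $\mathcal{A}=\{A_1,\ldots,A_m\}$ be a family of distinct subsets of $[n]=\{1,\ldots,n\}$ such that $|A_i| \pmod p\in K$ for every $i$ and $|A_i\cap A_j|\pmod p\in L$ for every $i\neq j$. If $n\ge s+\max_{1\le i\le r}k_i$, then \[ |\mathcal{A}|\le \binom{n-1}{s}+\binom{n-1}{s-1}+\cdots+\binom{n-1}{s-2r+1}. \]
   Context: Binomial coefficients $\binom{a}{b}$ with $b<0$ are interpreted as $0$. *)

(* Defs.v *)
From mathcomp Require Import all_boot.
Set Implicit Arguments. Unset Strict Implicit. Unset Printing Implicit Defensive.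

Definition res_in (p : nat) (S : {set 'I_p}) (m : nat) : bool :=
  [exists k in S, nat_of_ord k == m %% p].

(* Main.v *)
Require Import Defs.
From mathcomp Require Import all_boot all_algebra zify ring.
Set Implicit Arguments. Unset Strict Implicit. Unset Printing Implicit Defensive.
Import GRing.Theory.

(** Write n = N + 1, let t be the last point and D the set of the other N points. Over F_p, set
    phi_A(X) = prod_(l in L) (|A /\ (X + t)| - l) and
    h(X) = prod_(k in K) (|X| - k) (|X| - k + 1) for X <= D. The functions phi_A (A in the family)
    and h * x_J (J <= D, |J| <= s - 2r) are multilinear of degree at most s in N variables, so it
    is enough to show that they are independent. Evaluating a relation at the members of the
    family that contain t, then at the others, kills the coefficients of the phi_A, because h
    vanishes at every member. There remains a polynomial g of degree e <= s - 2r with h g = 0.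
    Replacing g by g(X + i) - g(X + j) lowers its degree by 1 and shifts the cardinals by 1; after
    k such steps g is symmetric, hence a one-variable polynomial in w = |X| <= N - 2k of degree at
    most e - k, vanishing unless w + k lies in H = K u (K - 1) modulo p. The hypotheses
    n >= s + max K and s + r <= p leave it more than e - k roots, or else leave no w with w + k
    in H. *)

Local Open Scope ring_scope.

(** * Functions on sets and their sums over subsets *)

Section SubsetSums.
Variables (R : comNzRingType) (T : finType).
Implicit Types (c : {set T} -> R) (D X Y J : {set T}).

Lemma sum_subsetsU1 c (x : T) X : x \notin X ->
  \sum_(J : {set T} | J \subset x |: X) c J =
  \sum_(J : {set T} | J \subset X) c J + \sum_(J : {set T} | J \subset X) c (x |: J).
Proof.
move=> xX; rewrite (bigID (fun J : {set T} => x \in J)) /= addrC; congr (_ + _).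
  apply: eq_bigl => J; apply/andP/idP => [[sJ xJ]|sJ].
    apply/subsetP => y yJ; have /setU1P[yx|//] := subsetP sJ y yJ.
    by rewrite -yx yJ in xJ.
  split; first by rewrite subsetU ?sJ ?orbT.
  by apply: contra xX; apply: (subsetP sJ).
rewrite (reindex_onto (fun J => x |: J) (fun J => J :\ x)) /=; last first.
  by move=> J /andP[_ xJ]; rewrite setD1K.
apply: eq_bigl => J; rewrite setU11 andbT; apply/andP/idP => [[sJ /eqP <-]|sJ].
  by rewrite subDset.
split; first by rewrite setUS.
by rewrite setU1K //; apply: contra xX; apply: (subsetP sJ).
Qed.

Lemma subset_sums_eq0 c D :
  (forall X, X \subset D -> \sum_(J : {set T} | J \subset X) c J = 0) ->
  forall X, X \subset D -> c X = 0.
Proof.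
move=> cD X; have [m] := ubnP #|X|; elim: m X => // m IH X ltX sXD.
have := cD X sXD; rewrite (bigD1 X) //= big1 ?addr0 // => J /andP[sJX neJX].
apply: IH; last exact: subset_trans sJX sXD.
have : (#|J| < #|X|)%N by apply: proper_card; rewrite properEneq neJX.
lia.
Qed.

Lemma sum_subsets_card (a : nat -> R) d X :
  (forall j, (d < j)%N -> a j = 0) ->
  \sum_(J : {set T} | J \subset X) a #|J| = \sum_(j < d.+1) 'C(#|X|, j)%:R * a j.
Proof.
move=> a0; rewrite (bigID (fun J : {set T} => (#|J| < d.+1)%N)) /= addrC big1 ?add0r; last first.
  by move=> J /andP[_]; rewrite -leqNgt; apply: a0.
rewrite (partition_big (fun J : {set T} => inord #|J| : 'I_d.+1) predT) //=.
apply: eq_bigr => j _; rewrite -cards_draws.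
rewrite (eq_bigr (fun=> a j)); last first.
  by move=> J /andP[/andP[_ lt] /eqP <-]; rewrite inordK.
rewrite sumr_const mulr_natl; congr (_ *+ _); apply: eq_card => J.
rewrite !inE unfold_in /= -andbA; congr (_ && _).
apply/andP/eqP => [[lt /eqP <-]|->]; first by rewrite inordK.
by rewrite ltn_ord; split=> //; apply/eqP/val_inj; rewrite /= inordK.
Qed.

(** Exchanging a point of [X :\: Y] for one of [Y :\: X] preserves [c] and brings [X] closer to
    [Y]. *)
Lemma swap_invariant_card c D :
  (forall i j J, i \in D -> j \in D -> J \subset D -> i \notin J -> j \notin J ->
     c (i |: J) = c (j |: J)) ->
  forall X Y, X \subset D -> Y \subset D -> #|X| = #|Y| -> c X = c Y.
Proof.
move=> sw X Y; have [m] := ubnP #|X :\: Y|; elim: m X Y => // m IH X Y ltm sX sY eXY.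
have [/eqP|[i iXY]] := set_0Vmem (X :\: Y).
  rewrite setD_eq0 => sXY; congr c; apply/eqP; rewrite eqEcard sXY; lia.
have [/eqP|[j jYX]] := set_0Vmem (Y :\: X).
  rewrite setD_eq0 => sYX; congr c; apply/eqP; rewrite eq_sym eqEcard sYX; lia.
move: iXY jYX; rewrite !inE => /andP[iY iX] /andP[jX jY].
have iXd : i \notin X :\ i by rewrite !inE eqxx.
have jXd : j \notin X :\ i by rewrite !inE (negbTE jX) andbF.
have sXd : X :\ i \subset D by apply: subset_trans sX; apply: subsetDl.
have [iD jD] := (subsetP sX i iX, subsetP sY j jY).
rewrite -(setD1K iX) (sw i j) //.
apply: IH => //.
- have : (#|(j |: X :\ i) :\: Y| < #|X :\: Y|)%N.
    apply: proper_card; apply/properP; split; last first.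
      by exists i; rewrite !inE ?iY ?iX //= eqxx orbF; apply: contraNneq iY => ->.
    apply/subsetP => x; rewrite !inE; case: eqP => [->|_] /=; first by rewrite jY.
    by case/and3P=> -> _ ->.
  lia.
- by rewrite subUset sub1set jD.
- by rewrite cardsU1 jXd -eXY (cardsD1 i X) iX.
Qed.

(** Here [c] depends on the cardinal alone, so its subset sums are a function [u] of [w = #|X|]. The
    last hypothesis isolates the one-variable uniqueness statement, with [Z] the levels of known
    vanishing. *)
Lemma symmetric_subset_sums_vanish e c D (Z : pred nat) :
  (forall i j J, i \in D -> j \in D -> J \subset D -> i \notin J -> j \notin J ->
     c (i |: J) = c (j |: J)) ->
  (forall J, J \subset D -> (e < #|J|)%N -> c J = 0) ->
  (forall X, X \subset D -> Z #|X| -> \sum_(J : {set T} | J \subset X) c J = 0) ->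
  (forall a : nat -> R, let u w := \sum_(j < e.+1) 'C(w, j)%:R * a j in
     (forall w, (w <= #|D|)%N -> Z w -> u w = 0) ->
     forall w, (w <= #|D|)%N -> u w = 0) ->
  forall J, J \subset D -> c J = 0.
Proof.
move=> sw deg van num; apply: subset_sums_eq0.
have exD j : (j <= #|D|)%N -> {J : {set T} | J \subset D & #|J| = j}.
  move=> jD; exists [set x in take j (enum D)].
    by apply/subsetP => x; rewrite inE => /mem_take; rewrite mem_enum.
  rewrite cardsE (card_uniqP _) ?take_uniq ?enum_uniq // size_takel // -cardE //.
(* The explicit cut-off at [e] matters: for large [j], [take j] saturates at all of [D], where [c]
   need not vanish. *)
pose a j := if (j <= e)%N then c [set x in take j (enum D)] else 0.
have ca J : J \subset D -> c J = a #|J|.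
  move=> sJ; rewrite /a; case: leqP => [_|/deg]; last exact.
  have [|J' sJ' cJ'] := exD #|J|; first exact: subset_leq_card.
  apply: (swap_invariant_card sw) => //.
    by apply/subsetP => x; rewrite inE => /mem_take; rewrite mem_enum.
  rewrite cardsE (card_uniqP _) ?take_uniq ?enum_uniq // size_takel // -cardE.
  exact: subset_leq_card.
have E X : X \subset D ->
  \sum_(J : {set T} | J \subset X) c J = \sum_(j < e.+1) 'C(#|X|, j)%:R * a j.
  move=> sX; rewrite -sum_subsets_card; last by move=> j ej; rewrite /a leqNgt ej.
  by apply: eq_bigr => J sJ; rewrite ca // (subset_trans sJ).
move=> X sX; rewrite E //; apply: num (subset_leq_card sX) => w wD Zw.
by have [J sJ Jw] := exD w wD; rewrite -Jw -E // van // Jw.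
Qed.

(* Repeatedly replacing [c] by [J |-> c (i |: J) - c (j |: J)] lowers the degree by one and
   shifts the levels by one, until [c J] depends on [#|J|] only. *)
Lemma subset_sums_vanish e c D (Z : pred nat) :
  (forall J, J \subset D -> (e < #|J|)%N -> c J = 0) ->
  (forall X, X \subset D -> Z #|X| -> \sum_(J : {set T} | J \subset X) c J = 0) ->
  (forall k (a : nat -> R), (k <= e)%N -> (2 * k <= #|D|)%N ->
     let u w := \sum_(j < (e - k).+1) 'C(w, j)%:R * a j in
     (forall w, (w + 2 * k <= #|D|)%N -> Z (w + k)%N -> u w = 0) ->
     forall w, (w + 2 * k <= #|D|)%N -> u w = 0) ->
  forall J, J \subset D -> c J = 0.
Proof.
elim: e c D Z => [|e IH] c D Z deg van num J0 sJ0;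
  have [sw|] := boolP [forall i in D, forall j in D, forall J : {set T},
   [&& J \subset D, i \notin J & j \notin J] ==> (c (i |: J) == c (j |: J))].
1,3: apply: (symmetric_subset_sums_vanish _ deg van _ sJ0).
1,3: move=> i j J iD jD sJ iJ jJ; apply/eqP.
1,2: by have := forallP (implyP (forallP (implyP (forallP sw i) iD) j) jD) J; rewrite sJ iJ jJ.
1,2: move=> a u va w wD; rewrite /u; have := num 0%N a; rewrite subn0 muln0 => /(_ isT isT).
1,2: apply; rewrite ?addn0 // => w'; rewrite !addn0; exact: va.
all: case/forall_inPn => i iD /forall_inPn[j jD] /forallPn[J].
all: rewrite negb_imply => /andP[/and3P[sJ iJ jJ]] /negP[].
  (* In degree 0 both values of [c] are zero, so no asymmetry can occur. *)
  by rewrite !deg ?subUset ?sub1set ?iD ?jD ?cardsU1 ?iJ ?jJ.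
have [->//|ij] := eqVneq i j.
(* Each difference step uses up two points of [D], hence the [2 * k] in the numerical hypothesis. *)
pose D' := D :\ i :\ j.
have cD : #|D| = #|D'|.+2.
  by rewrite (cardsD1 i D) iD (cardsD1 j (D :\ i)) !inE jD eq_sym ij.
have sD' X : X \subset D' -> [/\ X \subset D, i \notin X & j \notin X].
  move=> /subsetP sX; split; first by apply/subsetP => x /sX; rewrite !inE => /and3P[].
    by apply/negP => /sX; rewrite !inE eqxx andbF.
  by apply/negP => /sX; rewrite !inE eqxx.
rewrite -subr_eq0; apply/eqP.
apply: (IH (fun J => c (i |: J) - c (j |: J)) D' (fun w => Z w.+1))
  => [X /sD'[sX iX jX] eX|X /sD'[sX iX jX] ZX|k a ke kD u va w wD|].
- by rewrite !deg ?subrr ?subUset ?sub1set ?iD ?jD ?cardsU1 ?iX ?jX.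
(* The sums over subsets of [i |: X] and of [j |: X] share the part over subsets of [X], which
   cancels. *)
- have Hi := van (i |: X); have Hj := van (j |: X).
  rewrite sum_subsetsU1 // subUset sub1set iD sX cardsU1 iX in Hi.
  rewrite sum_subsetsU1 // subUset sub1set jD sX cardsU1 jX in Hj.
  rewrite sumrB; apply/eqP; rewrite subr_eq0; apply/eqP.
  by apply: (addrI (\sum_(J : {set T} | J \subset X) c J)); rewrite Hi // Hj.
- rewrite /u -subSS; apply: num; [lia|lia| |lia] => v vD Zv.
  by rewrite subSS; apply: va; [lia | rewrite -addnS].
- apply/subsetP => x xJ; rewrite !inE (subsetP sJ) // andbT.
  by apply/andP; split; [apply: contraNneq jJ => <- | apply: contraNneq iJ => <-].
Qed.
End SubsetSums.

(** * Roots of binomial sums modulo a prime *)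

Section PrimeField.
Variable p : nat.
Hypothesis pr_p : prime p.

Lemma eq_natr_Fp m n : (m%:R == n%:R :> 'F_p) = (m == n %[mod p])%N.
Proof. by rewrite -val_eqE /= !val_Fp_nat. Qed.

Lemma eq_small_natr_Fp m n : (m < p)%N -> (n < p)%N -> (m%:R == n%:R :> 'F_p) = (m == n).
Proof. by move=> mp np; rewrite eq_natr_Fp !modn_small. Qed.

Lemma natr_fact_neq0 j : (j < p)%N -> j`!%:R != 0 :> 'F_p.
Proof.
rewrite (eq_natr_Fp _ 0) mod0n -/(dvdn p _).
elim: j => [|j IH] jp; first by rewrite fact0 dvdn1 gtn_eqF ?prime_gt1.
by rewrite factS Euclid_dvdM // negb_or gtnNdvd //= IH // ltnW.
Qed.

Lemma prod_natrB_ffact w j : \prod_(i < j) (w%:R - i%:R) = (w ^_ j)%:R :> 'F_p.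
Proof.
have [wj|jw] := ltnP w j.
  by rewrite ffact_small // (bigD1 (Ordinal wj)) //= subrr mul0r.
rewrite ffact_prod natr_prod; apply: eq_bigr => i _; rewrite natrB //.
exact: leq_trans (ltnW (ltn_ord i)) jw.
Qed.

(** For [j <= d < p] the factorial of [j] is invertible, so ['C(w, j)] is a falling factorial
    divided by it, a polynomial in [w] of degree [j]. *)
Lemma binomial_sum_polynomial (a : nat -> 'F_p) d : (d < p)%N ->
  exists2 U : {poly 'F_p}, (size U <= d.+1)%N &
    forall w, U.[w%:R] = \sum_(j < d.+1) 'C(w, j)%:R * a j.
Proof.
move=> dp.
exists (\sum_(j < d.+1) (a j / j`!%:R) *: \prod_(i < j) ('X - (i%:R)%:P)).
  apply: (leq_trans (size_sum _ _ _)); apply/bigmax_leqP => j _.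
  apply: (leq_trans (size_scale_leq _ _)).
  by rewrite size_prod_XsubC /index_enum -enumT size_enum_ord.
move=> w; rewrite horner_sum; apply: eq_bigr => j _.
rewrite hornerZ horner_prod; under eq_bigr do rewrite hornerXsubC.
rewrite prod_natrB_ffact -bin_ffact natrM.
have := @natr_fact_neq0 j; rewrite (leq_trans (ltn_ord j) dp) => /(_ isT) nz.
by field.
Qed.

Lemma binomial_sum_eq0 (a : nat -> 'F_p) d (ws : seq nat) : (d < p)%N ->
  uniq ws -> all (ltn^~ p) ws -> (d < size ws)%N ->
  (forall w, w \in ws -> \sum_(j < d.+1) 'C(w, j)%:R * a j = 0) ->
  forall w, \sum_(j < d.+1) 'C(w, j)%:R * a j = 0.
Proof.
move=> dp uws lws sws van w; have [U sU evU] := binomial_sum_polynomial a dp.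
rewrite -evU (@roots_geq_poly_eq0 _ U [seq v%:R | v <- ws]) ?horner0 //.
- by apply/allP => _ /mapP[v vws ->]; rewrite /root evU van.
- rewrite map_inj_in_uniq // => v v' /(allP lws) vp /(allP lws) vp' /eqP.
  by rewrite eq_small_natr_Fp // => /eqP.
- by rewrite size_map (leq_trans sU).
Qed.

Lemma count_shift_mem_le (S : {set 'F_p}) k m : (m <= p)%N ->
  (count (fun w => (w + k)%:R \in S) (iota 0 m) <= #|S|)%N.
Proof.
move=> mp; rewrite -size_filter -(size_map (fun w : nat => (w + k)%:R : 'F_p)) cardE.
apply: uniq_leq_size.
  rewrite map_inj_in_uniq ?filter_uniq ?iota_uniq // => v w.
  rewrite !mem_filter !mem_iota /= => /andP[_ vm] /andP[_ wm] /eqP.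
  rewrite !natrD (inj_eq (addIr _)) eq_small_natr_Fp => [/eqP|//|//]; first by [].
    lia.
  lia.
by move=> _ /mapP[v + ->]; rewrite mem_filter mem_enum => /andP[].
Qed.

(** The set H = K u (K - 1): the possible sizes modulo [p] of a member once the last point is
    removed. *)
Definition shifted_residues (K : {set 'I_p}) : {set 'F_p} :=
  [set (nat_of_ord k)%:R | k in K] :|: [set (nat_of_ord k)%:R - 1 | k in K].

Lemma card_shifted_residues K : (#|shifted_residues K| <= 2 * #|K|)%N.
Proof.
rewrite mul2n -addnn; apply: leq_trans (leq_card_setU _ _) _.
by apply: leq_add; apply: leq_imset_card.
Qed.

(** Lowering a residue by 1 keeps it at most the maximum of [K], except that 0 wraps around to
    [p - 1]; the strict bounds avoid both. *)
Lemma shifted_residues_gap (K : {set 'I_p}) v :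
  (\max_(k in K) nat_of_ord k < v)%N -> (v < p.-1)%N -> v%:R \notin shifted_residues K.
Proof.
move=> Kv vp; have maxK (k : 'I_p) : k \in K -> (k < v)%N.
  by move=> kK; apply: leq_ltn_trans Kv; apply: (leq_bigmax_cond k).
apply/negP => /setUP[] /imsetP[k kK /eqP]; have := maxK k kK; have := ltn_ord k => kp kv.
  rewrite eq_small_natr_Fp //; lia.
rewrite -subr_eq0 opprB addrA subr_eq0 natr1 eq_small_natr_Fp //; lia.
Qed.

Lemma binomial_sum_vanish (K : {set 'I_p}) s e k N (a : nat -> 'F_p) :
  (0 < #|K|)%N -> (e + 2 * #|K| <= s)%N -> (s + #|K| <= p)%N ->
  (s + \max_(k in K) nat_of_ord k <= N.+1)%N ->
  (k <= e)%N -> (2 * k <= N)%N ->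
  let u w := \sum_(j < (e - k).+1) 'C(w, j)%:R * a j in
  (forall w, (w + 2 * k <= N)%N -> (w + k)%:R \notin shifted_residues K -> u w = 0) ->
  forall w, (w + 2 * k <= N)%N -> u w = 0.
Proof.
move=> K0 es sp sN ke kN u van.
set M := (\max_(k in K) _)%N in sN *.
have ekp : (e - k < p)%N by lia.
(* Among 0, ..., [m - 1] at least [m - #|S|] values are roots, more than the degree bound
   [e - k]. *)
have many m (S : {set 'F_p}) : (m <= p)%N -> (m + 2 * k <= N.+1)%N ->
    (forall w, (w < m)%N -> (w + k)%:R \in shifted_residues K -> (w + k)%:R \in S) ->
    (e - k + #|S| < m)%N -> forall w, u w = 0.
  move=> mp mN KS Sm.
  apply: (@binomial_sum_eq0 a _ [seq w <- iota 0 m | (w + k)%:R \notin shifted_residues K] ekp).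
  - by rewrite filter_uniq ?iota_uniq.
  - apply/allP => w; rewrite mem_filter mem_iota /= => /andP[_ wm]; lia.
  - have := count_predC (fun w => (w + k)%:R \in shifted_residues K) (iota 0 m).
    have := count_shift_mem_le S k mp; rewrite size_filter size_iota.
    set cP := count (predC _) _; rewrite -[X in (_ < X)%N]/cP.
    have : (count (fun w => (w + k)%:R \in shifted_residues K) (iota 0 m) <=
            count (fun w => (w + k)%:R \in S) (iota 0 m))%N.
      rewrite -!size_filter; apply: uniq_leq_size; first by rewrite filter_uniq ?iota_uniq.
      move=> w; rewrite !mem_filter mem_iota /= => /andP[hw wm].
      by rewrite (KS w wm hw).
    lia.
  - move=> w; rewrite mem_filter mem_iota /= => /andP[wS wm]; apply: van => //; lia.
have cS := card_shifted_residues K.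
(* The levels cover all residues: [e + 2 * #|K| <= s < p] leaves enough roots. *)
have [Np|Np] := leqP p (N.+1 - 2 * k).
  move=> w _; apply: (many p (shifted_residues K)) => //; lia.
(* There are at least [s + M - 2 * k] levels, while [e - k + 2 * #|K| <= s - k]; [k < M] makes the
   gap strict. *)
have [kM|Mk] := ltnP k M.
  move=> w _; apply: (many (N.+1 - 2 * k)%N (shifted_residues K)) => //; lia.
(* Every [w + k] exceeds [M], so the first that can be forbidden is [p - 1]. Either no level is
   forbidden, or all [w < p - 1 - k] are roots. *)
have [ltMk|] := ltnP M k.
  have [nohit|] := boolP (all (fun w => (w + k)%:R \notin shifted_residues K)
                                (iota 0 (N.+1 - 2 * k))).
    move=> w wN; apply: van => //; apply: (allP nohit); rewrite mem_iota; lia.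
  case/allPn => v; rewrite mem_iota => /andP[_ vN] /negbNE hv.
  have vp : (p.-1 <= v + k)%N.
    rewrite leqNgt; apply: contraL hv; apply: shifted_residues_gap; rewrite -/M; lia.
  move=> w _; apply: (many (p.-1 - k)%N set0) => //; rewrite ?cards0; try lia.
  by move=> x xp; rewrite (negbTE (shifted_residues_gap _ _)) // -?/M; lia.
move=> kM; have {kM Mk} kM : k = M by lia.
have [k0 k0K Mk0] : {k0 | k0 \in K & M = nat_of_ord k0} by apply: eq_bigmax_cond.
(* [k - 1] is a forbidden residue that no [w + k] with [w <= N - 2k] reaches: this gains one root. *)
have k1S : k%:R - 1 \in shifted_residues K.
  by rewrite kM Mk0; apply/setUP; right; apply: imset_f.
move=> w _; apply: (many (N.+1 - 2 * k)%N (shifted_residues K :\ (k%:R - 1))); try lia.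
  move=> v vN hv; rewrite in_setD1 hv andbT -subr_eq0 natrD opprB addrA subr_eq0.
  rewrite -{2}[k%:R]add0r -addrA [_ + 1]addrC addrA (inj_eq (addIr _)) natr1.
  rewrite (eq_small_natr_Fp (n:=0)) ?prime_gt0 //; lia.
move: cS; rewrite (cardsD1 (k%:R - 1)) k1S add1n; move: #|_ :\ _| => c; lia.
Qed.

End PrimeField.

(** * Linear independence and multilinear functions *)

Lemma free_image (F : fieldType) (V : vectType F) (I : finType) (A : {pred I}) (v : I -> V) :
  (forall k : I -> F, \sum_(i in A) k i *: v i = 0 -> forall i, i \in A -> k i = 0) ->
  free (image v A).
Proof.
move=> indep; apply/(@freeP _ _ _ (image_tuple v A)) => k kv i.
have iA := enum_valP i; rewrite -[i](enum_valK_in iA).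
apply: (indep (fun x => k (enum_rank_in iA x))) => //.
rewrite big_enum_val -[RHS]kv; apply: eq_bigr => j _.
by rewrite enum_valK_in nth_image.
Qed.

Section Multilinear.
Variables (F : fieldType) (T : finType) (D : {set T}).

(** The monomial x_J evaluated at the 0/1 point [X]; [F^o] is [F] as a vector space over itself. *)
Definition monomial (J : {set T}) : {ffun {set T} -> F^o} := [ffun X : {set T} => (J \subset X)%:R].

Definition small_subsets d : {set {set T}} := [set J : {set T} | J \subset D & (#|J| <= d)%N].

Definition multilinear d : {vspace {ffun {set T} -> F^o}} :=
  <<image monomial (mem (small_subsets d))>>%VS.

Lemma monomial_multilinear (J : {set T}) d :
  J \subset D -> (#|J| <= d)%N -> monomial J \in multilinear d.
Proof. by move=> sJ Jd; apply/memv_span/image_f; rewrite inE sJ. Qed.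

(** On 0/1 points a variable equals its square, so multiplying [monomial J] by the variable of [x]
    gives [monomial (x |: J)]. *)
Lemma multilinear_mul_affine d f (B : {set T}) (b : F) : B \subset D ->
  f \in multilinear d ->
  [ffun X : {set T} => f X * (#|B :&: X|%:R + b)] \in multilinear d.+1.
Proof.
move=> sB /(@coord_span _ _ _ (image_tuple _ _)) ->.
set k := coord _; set S := small_subsets d.
have -> : [ffun X : {set T} =>
    (\sum_(i < #|S|) k i f *: (image_tuple monomial (mem S))`_i) X * (#|B :&: X|%:R + b)] =
  \sum_(i < #|S|) k i f *:
    (b *: monomial (enum_val i) + \sum_(x in B) monomial (x |: enum_val i)).
  apply/ffunP => X; rewrite ffunE !sum_ffunE mulr_suml; apply: eq_bigr => i _.
  rewrite nth_image !ffunE sum_ffunE -scalerAl; congr (_ * _).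
  rewrite mulrDr addrC mulrC; congr (_ + _).
  rewrite -sum1_card natr_sum (eq_bigl (fun x => (x \in B) && (x \in X))); last first.
    by move=> x; rewrite inE.
  rewrite big_mkcondr mulr_sumr; apply: eq_bigr => x _.
  by rewrite ffunE subUset sub1set; case: (x \in X); rewrite ?mulr1 ?mulr0.
apply: memv_suml => i _; have := enum_valP i; rewrite inE => /andP[sJ Jd].
apply/memvZ/memvD; first by apply/memvZ/monomial_multilinear => //; lia.
apply: memv_suml => x xB; apply: monomial_multilinear.
  by rewrite subUset sub1set (subsetP sB).
by rewrite cardsU1; case: (_ \notin _) => /=; lia.
Qed.

Lemma multilinear_mul_prod_affine (I : Type) (s : seq I) (b : I -> F) d f (B : {set T}) :
  B \subset D -> f \in multilinear d ->
  [ffun X : {set T} => f X * \prod_(i <- s) (#|B :&: X|%:R + b i)] \in multilinear (d + size s).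
Proof.
move=> sB; elim: s d f => [|i s IH] d f fd.
  by rewrite addn0 (_ : finfun _ = f) //; apply/ffunP => X; rewrite ffunE big_nil mulr1.
have := IH _ _ (multilinear_mul_affine (b i) sB fd); rewrite /= addSnnS.
rewrite (_ : finfun _ = [ffun X : {set T} => f X * \prod_(i <- i :: s) (#|B :&: X|%:R + b i)]) //.
by apply/ffunP => X; rewrite !ffunE big_cons mulrA.
Qed.

(** The guard [i <= s] drops the binomials with negative lower index, which truncated subtraction
    would turn into 1. *)
Lemma card_subsets_range s m :
  #|[set J : {set T} | J \subset D & (#|J| <= s < #|J| + m)%N]| =
  (\sum_(i < m | i <= s) 'C(#|D|, s - i))%N.
Proof.
case: m => [|m].
  rewrite big_ord0; apply/eqP; rewrite cards_eq0; apply/eqP/setP => J; rewrite !inE; lia.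
rewrite -sum1_card (partition_big (fun J : {set T} => inord (s - #|J|) : 'I_m.+1)
  (fun i : 'I_m.+1 => (i <= s)%N)) /=; last first.
  by move=> J; rewrite inE => /and3P[_ Js sJ]; rewrite inordK; lia.
apply: eq_bigr => i si; rewrite -cards_draws sum1_card; apply: eq_card => J.
rewrite !inE unfold_in /= inE -andbA; congr (_ && _).
have im := ltn_ord i; apply/andP/eqP => [[/andP[Js sJ] /eqP <-]|Js].
  by rewrite inordK; lia.
by split; [lia | apply/eqP/val_inj; rewrite /= inordK; lia].
Qed.
End Multilinear.

(** * The independent functions attached to the family, and the bound *)

Lemma res_in_natr (p : nat) (S : {set 'I_p}) m : prime p -> res_in S m ->
  exists2 k, k \in S & m%:R = (nat_of_ord k)%:R :> 'F_p.
Proof.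
move=> pr_p /existsP[k /andP[kS /eqP km]]; exists k => //.
by apply/eqP; rewrite eq_natr_Fp // km modn_mod.
Qed.

Section IndependentFamily.
Variables (p N : nat) (K L : {set 'I_p}) (A : {set {set 'I_N.+1}}).
Hypotheses (pr_p : prime p) (KL : [disjoint K & L]) (K_gt0 : (0 < #|K|)%N).
Hypothesis A_K : forall X, X \in A -> res_in K #|X|.
Hypothesis A_L : forall X Y, X \in A -> Y \in A -> X != Y -> res_in L #|X :&: Y|.
Hypothesis max_le : (#|L| + \max_(k in K) nat_of_ord k <= N.+1)%N.

Let t : 'I_N.+1 := ord_max.
Let D : {set 'I_N.+1} := [set~ t].
Let V := {ffun {set 'I_N.+1} -> ('F_p)^o}.

(* The value at [X] is the product of the [#|Y :&: (t |: X)| - l]: only the sets containing [t]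
   are tested, so that the number of variables drops to [N]. *)
Definition intersection_poly (Y : {set 'I_N.+1}) : V :=
  [ffun X : {set 'I_N.+1} => monomial 'F_p set0 X *
    \prod_(l <- enum L) (#|(Y :\ t) :&: X|%:R + ((t \in Y)%:R - (nat_of_ord l)%:R))].

(** The polynomial h: its first product vanishes at members avoiding [t], its second at members
    containing [t], whose trace on [D] has one point fewer. *)
Definition size_poly_at (X : {set 'I_N.+1}) : 'F_p :=
  \prod_(k <- enum K) (#|D :&: X|%:R + - (nat_of_ord k)%:R) *
  \prod_(k <- enum K) (#|D :&: X|%:R + (1 - (nat_of_ord k)%:R)).

Definition size_multiple (J : {set 'I_N.+1}) : V :=
  [ffun X => monomial 'F_p J X * size_poly_at X].

(** The condition says that adding [t] to [X] does not change [Y :&: X]. *)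
Lemma intersection_polyE (X Y : {set 'I_N.+1}) : (t \in X) || (t \notin Y) ->
  intersection_poly Y X = \prod_(l in L) (#|Y :&: X|%:R - (nat_of_ord l)%:R).
Proof.
move=> tXY; rewrite !ffunE sub0set mul1r big_enum /=; apply: eq_bigr => l _.
rewrite addrA -natrD; congr (_%:R - _).
rewrite [RHS](cardsD1 t) addnC setIDAC in_setI.
by congr (_ + _)%N; case: (t \in X) tXY; case: (t \in Y).
Qed.

Lemma intersection_poly_diag X : X \in A -> intersection_poly X X != 0.
Proof.
move=> XA; rewrite intersection_polyE ?orbN // setIid prodf_seq_neq0.
apply/allP => l _; apply/implyP => lL; rewrite subr_eq0.
have [k kK ->] := res_in_natr pr_p (A_K XA).
rewrite eq_small_natr_Fp //; apply: contraTneq KL => kl.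
by apply/pred0Pn; exists k; rewrite /= kK (val_inj kl).
Qed.

Lemma intersection_poly_offdiag X Y : X \in A -> Y \in A -> X != Y ->
  (t \in X) || (t \notin Y) -> intersection_poly Y X = 0.
Proof.
move=> XA YA XY tXY; rewrite intersection_polyE //; apply/eqP/prodf_eq0.
rewrite eq_sym in XY; have [l lL ->] := res_in_natr pr_p (A_L YA XA XY).
by exists l => //; rewrite subrr.
Qed.

Lemma size_poly_at_family X : X \in A -> size_poly_at X = 0.
Proof.
move=> XA; have [k kK Xk] := res_in_natr pr_p (A_K XA).
apply/eqP; rewrite mulf_eq0 !big_enum /=; move: Xk.
rewrite (cardsD1 t X) setIC -setDE; case: (t \in X) => /= Xk; apply/orP.
  right; apply/prodf_eq0; exists k => //.
  by rewrite addrA natr1 -add1n Xk subrr.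
by left; apply/prodf_eq0; exists k => //; rewrite -Xk subrr.
Qed.

Lemma size_poly_at_neq0 (X : {set 'I_N.+1}) : X \subset D ->
  #|X|%:R \notin shifted_residues K -> size_poly_at X != 0.
Proof.
move=> /setIidPr XD; rewrite !inE negb_or => /andP[X0 X1].
rewrite /size_poly_at XD mulf_neq0 // prodf_seq_neq0; apply/allP => k; rewrite mem_enum => kK.
  by rewrite /= subr_eq0; apply: contraNneq X0 => ->; apply: imset_f.
rewrite /= addrA subr_eq0; apply: contraNneq X1 => Xk; apply/imsetP; exists k => //.
by rewrite -Xk addrK.
Qed.

Lemma card_restriction_domain : #|D| = N.
Proof. by rewrite cardsC1 card_ord. Qed.

Lemma size_multiples_independent (c : {set 'I_N.+1} -> 'F_p) :
  (forall J : {set 'I_N.+1}, J \subset D -> (#|L| < #|J| + 2 * #|K|)%N -> c J = 0) ->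
  (forall X : {set 'I_N.+1}, X \subset D -> #|X|%:R \notin shifted_residues K ->
     \sum_(J : {set 'I_N.+1} | J \subset X) c J = 0) ->
  forall J : {set 'I_N.+1}, J \subset D -> c J = 0.
Proof.
move=> deg van J sJ; have [LK|KL2] := ltnP #|L| (2 * #|K|)%N.
  by apply: deg => //; lia.
apply: (@subset_sums_vanish _ _ (#|L| - 2 * #|K|) c D
  (fun w => w%:R \notin shifted_residues K)) sJ => // [X sX ltX|k a ke kD].
  by apply: deg => //; lia.
rewrite card_restriction_domain in kD *.
apply: (binomial_sum_vanish pr_p K_gt0 _ _ max_le) => //; first lia.
(* Disjointness inside ['I_p] yields [#|L| + #|K| <= p]. *)
have := max_card (K :|: L); rewrite card_ord cardsU disjoint_setI0 // cards0; lia.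
Qed.

Definition joint_family (i : {set 'I_N.+1} + {set 'I_N.+1}) : V :=
  match i with inl Y => intersection_poly Y | inr J => size_multiple J end.

Definition joint_index : pred ({set 'I_N.+1} + {set 'I_N.+1}) := fun i =>
  match i with inl Y => Y \in A | inr J => (J \subset D) && (#|J| + 2 * #|K| <= #|L|)%N end.

Lemma joint_family_multilinear i : joint_index i -> joint_family i \in multilinear 'F_p D #|L|.
Proof.
case: i => [Y _|J /andP[sJ JL]] /=.
  rewrite -[#|L|]add0n [X in (0 + X)%N]cardE; apply: multilinear_mul_prod_affine.
    by rewrite /D setDE subsetIr.
  by apply: monomial_multilinear; rewrite ?sub0set ?cards0.
have Jmon : monomial 'F_p J \in multilinear 'F_p D (#|L| - 2 * #|K|).
  by apply: monomial_multilinear => //; lia.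
have := multilinear_mul_prod_affine (enum K) (fun k => 1 - (nat_of_ord k)%:R) (subxx D)
  (multilinear_mul_prod_affine (enum K) (fun k => - (nat_of_ord k)%:R) (subxx D) Jmon).
rewrite -cardE (_ : (_ + _ + _)%N = #|L|); last lia.
rewrite (_ : finfun _ = size_multiple J) //.
by apply/ffunP => X; rewrite !ffunE mulrA.
Qed.

Lemma joint_family_free : free (image joint_family joint_index).
Proof.
apply: free_image => k; rewrite big_sumType /= => k0.
have at_ X : \sum_(Y in A) k (inl Y) * intersection_poly Y X +
    (\sum_(J : {set 'I_N.+1} | (J \subset D) && (#|J| + 2 * #|K| <= #|L|)%N)
       k (inr J) * monomial 'F_p J X) * size_poly_at X = 0.
  have := congr1 (fun f : V => f X) k0; rewrite /= !ffunE !sum_ffunE => E.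
  rewrite -[RHS]E; congr (_ + _).
    by apply: eq_bigr => Y _; rewrite !ffunE.
  by rewrite mulr_suml; apply: eq_bigr => J _; rewrite !ffunE -mulrA.
have diag X : X \in A ->
    (forall Y, Y \in A -> Y != X -> k (inl Y) = 0 \/ (t \in X) || (t \notin Y)) ->
    k (inl X) = 0.
  move=> XA oth; have := at_ X; rewrite size_poly_at_family // mulr0 addr0.
  rewrite (bigD1 X) //= big1 ?addr0 => [/eqP|Y /andP[YA YX]]; last first.
    case: (oth Y YA YX) => [->|tXY]; first by rewrite mul0r.
    by rewrite intersection_poly_offdiag ?mulr0 // eq_sym.
  by rewrite mulf_eq0 (negbTE (intersection_poly_diag XA)) orbF => /eqP.
(* At a member containing [t], all other intersection polynomials vanish. At a member avoiding [t],
   only those of members containing [t] may survive, and their coefficients are then already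
   zero. *)
have k_in Y : Y \in A -> t \in Y -> k (inl Y) = 0.
  by move=> YA tY; apply: diag => // Z _ _; right; rewrite tY.
have k_all Y : Y \in A -> k (inl Y) = 0.
  move=> YA; apply: diag => // Z ZA _.
  by case tZ: (t \in Z); [left; apply: k_in | right; rewrite orbT].
case=> [Y|J] /=; first exact: k_all.
case/andP=> sJ JL.
pose c (J : {set 'I_N.+1}) := if (J \subset D) && (#|J| + 2 * #|K| <= #|L|)%N then k (inr J) else 0.
suff : c J = 0 by rewrite /c sJ JL.
apply: size_multiples_independent sJ => [I sI IL|X sX Xres].
  by rewrite /c sI leqNgt IL.
have := at_ X; rewrite big1 ?add0r => [/eqP|Y YA]; last by rewrite k_all ?mul0r.
rewrite mulf_eq0 (negbTE (size_poly_at_neq0 sX Xres)) orbF => /eqP E.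
rewrite -[RHS]E big_mkcond [RHS]big_mkcond; apply: eq_bigr => I _; rewrite /c ffunE.
by case: (I \subset X); case: (_ && _); rewrite ?mulr1 ?mulr0.
Qed.

(** The free family lies in a span of [#|small_subsets D #|L| |] monomials; subtracting the
    multiples of h leaves the subsets of [D] of size above [#|L| - 2 * #|K|]. *)
Lemma modular_family_bound :
  (#|A| <= \sum_(i < 2 * #|K| | i <= #|L|) 'C(N, #|L| - i))%N.
Proof.
pose S2 := [set J : {set 'I_N.+1} | J \subset D & (#|J| + 2 * #|K| <= #|L|)%N].
have dimle : (#|joint_index| <= #|small_subsets D #|L| |)%N.
  rewrite -(size_image joint_family) -(eqP joint_family_free).
  have sub : (<<image joint_family joint_index>> <= multilinear 'F_p D #|L|)%VS.
    by apply/span_subvP => _ /imageP[i iI ->]; apply: joint_family_multilinear.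
  by apply: leq_trans (dimvS sub) (leq_trans (dim_span _) _); rewrite size_image.
have cj : #|joint_index| = (#|A| + #|S2|)%N.
  rewrite -[LHS]sum1_card big_sumType /= !sum1_card; congr (_ + _)%N.
  by apply: eq_card => J; rewrite inE.
have S2s : S2 \subset small_subsets D #|L|.
  by apply/subsetP => J; rewrite !inE => /andP[->]; lia.
have := card_subsets_range D #|L| (2 * #|K|); rewrite card_restriction_domain => <-.
have -> : [set J : {set 'I_N.+1} | J \subset D & (#|J| <= #|L| < #|J| + 2 * #|K|)%N]
    = small_subsets D #|L| :\: S2.
  by apply/setP => J; rewrite !inE; case: (J \subset D) => //=; lia.
by rewrite cardsDS // leq_subRL ?subset_leq_card // addnC -cj.
Qed.
End IndependentFamily.

Local Close Scope ring_scope.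

Theorem theorem2p10 (p n : nat) (K L : {set 'I_p}) (F : {set {set 'I_n}}) :
  prime p ->
  [disjoint K & L] ->
  0 < #|K| ->
  (forall A, A \in F -> res_in K #|A|) ->
  (forall A B, A \in F -> B \in F -> A != B -> res_in L #|A :&: B|) ->
  #|L| + \max_(k in K) nat_of_ord k <= n ->
  #|F| <= \sum_(i < (2 * #|K|) | i <= #|L|) 'C(n.-1, #|L| - i).
Proof.
case: n F => [|N] F pr_p KL K0 FK FL maxN; last exact: modular_family_bound.
(* For [n = 0] there is no last point: the term [i = 0] is 1, and the empty ground set has a single
   subset. *)
have L0 : #|L| = 0 by lia.
have K2 : 0 < 2 * #|K| by lia.
rewrite L0 (bigD1 (Ordinal K2)) //= bin0.
apply: leq_trans (leq_addr _ _); apply: leq_trans (max_card _) _.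
by rewrite -cardsT -powersetT card_powerset cardsT card_ord.
Qed.
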